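(* Fix a time index $n\ge1$ and $(\mathbf u_h^{n-1},\xi_h^{n-1},p_h^{n-1})\in \mathbf V_h\times W_h\times M_h$. Let $(\mathbf u_h^n,\xi_h^n,p_h^n)$ be the solution of the $n$-th step of the coupled algorithm, and let $(\mathbf u_h^{n,i},\xi_h^{n,i},p_h^{n,i})_{i\ge 0}$ be the iterates of the iterative decoupled algorithm in the same time step (both defined in the context, with the same previous-step values). Set $e_{\mathbf u}^i=\mathbf u_h^{n,i}-\mathbf u_h^n$, $e_\xi^i=\xi_h^{n,i}-\xi_h^n$, $e_p^i=p_h^{n,i}-p_h^n$. If $c_0>0$, then $$\lim_{i\to\infty}\|e_\xi^i\|_{L^2(\Omega)}=0,\qquad \lim_{i\to\infty}\|e_p^i\|_{L^2(\Omega)}=0,\qquad \lim_{i\to\infty}\|\varepsilon(e_{\mathbf u}^i)\|_{L^2(\Omega)}=0.$$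
   Context: Setting. $\Omega\subset\mathbb R^d$ ($d=2$ or $3$) is a bounded polygonal (polyhedral) domain, with $\partial\Omega=\Gamma_d\cup\Gamma_t=\Gamma_p\cup\Gamma_f$, $|\Gamma_d|>0$, $|\Gamma_p|>0$ ($\Gamma_d,\Gamma_p$ are the Dirichlet parts for displacement and pressure, $\Gamma_t,\Gamma_f$ the Neumann parts). $(\cdot,\cdot)$ is the $L^2(\Omega)$ inner product and $\langle\cdot,\cdot\rangle_\Gamma$ the $L^2(\Gamma)$ inner product; $\varepsilon(\mathbf u)=\frac12(\nabla\mathbf u+(\nabla\mathbf u)^T)$. Parameters: $\mu>0$, $\lambda>0$, $c_0\ge 0$, $\alpha>0$ (Biot–Willis constant), $K>0$ (hydraulic conductivity), time step $\Delta t>0$. Time-independent data: $\mathbf f\in \mathbf L^2(\Omega)$, $\mathbf h\in\mathbf L^2(\Gamma_t)$, $Q_s\in L^2(\Omega)$, $g_2\in L^2(\Gamma_f)$. Finite element spaces on a triangulation $T_h$ of $\Omega$ (Taylor–Hood for $(\mathbf u,\xi)$, $P_1$ for $p$): $\mathbf V_h=\{\mathbf v_h\in \mathbf C^0(\bar\Omega): \mathbf v_h|_{\Gamma_d}=0,\ \mathbf v_h|_\tau\in \mathbf P_2(\tau)\ \forall\tau\in T_h\}$, $W_h=\{\phi_h\in C^0(\bar\Omega):\phi_h|_\tau\in P_1(\tau)\ \forall \tau\in T_h\}$, $M_h=\{\psi_h\in C^0(\bar\Omega):\psi_h|_{\Gamma_p}=0,\ \psi_h|_\tau\in P_1(\tau)\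 \forall\tau\in T_h\}$. Coupled algorithm, $n$-th step: given $(\mathbf u_h^{n-1},\xi_h^{n-1},p_h^{n-1})$, find $(\mathbf u_h^n,\xi_h^n,p_h^n)\in\mathbf V_h\times W_h\times M_h$ such that for all $(\mathbf v_h,\phi_h,\psi_h)\in \mathbf V_h\times W_h\times M_h$: $$2\mu(\varepsilon(\mathbf u_h^n),\varepsilon(\mathbf v_h))-(\xi_h^n,\operatorname{div}\mathbf v_h)=(\mathbf f,\mathbf v_h)+\langle\mathbf h,\mathbf v_h\rangle_{\Gamma_t},$$ $$(\operatorname{div}\mathbf u_h^n,\phi_h)+\tfrac1\lambda(\xi_h^n,\phi_h)-\tfrac\alpha\lambda(p_h^n,\phi_h)=0,$$ $$(c_0+\tfrac{\alpha^2}\lambda)(p_h^n,\psi_h)-\tfrac\alpha\lambda(\xi_h^n,\psi_h)+K\Delta t(\nabla p_h^n,\nabla\psi_h)=\Delta t(Q_s,\psi_h)+\Delta t\langle g_2,\psi_h\rangle_{\Gamma_f}+(c_0+\tfrac{\alpha^2}\lambda)(p_h^{n-1},\psi_h)-\tfrac\alpha\lambda(\xi_h^{n-1},\psi_h).$$ Iterative decoupled algorithm in time step $n$: initialize $\mathbf u_h^{n,0}=\mathbf u_h^{n-1}$, $\xi_h^{n,0}=\xi_h^{n-1}$, $p_h^{n,0}=p_h^{n-1}$. For $i\ge 1$: Step 1: given $\xi_h^{n,i-1}\in W_h$, find $p_h^{n,i}\in M_h$ such that for all $\psi_h\in M_h$ $$(c_0+\tfrac{\alpha^2}\lambda)(p_h^{n,i},\psi_h)+K\Delta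 t(\nabla p_h^{n,i},\nabla\psi_h)=(c_0+\tfrac{\alpha^2}\lambda)(p_h^{n-1},\psi_h)+\tfrac\alpha\lambda(\xi_h^{n,i-1}-\xi_h^{n-1},\psi_h)+\Delta t(Q_s,\psi_h)+\Delta t\langle g_2,\psi_h\rangle_{\Gamma_f}.$$ Step 2: given $p_h^{n,i}$, find $(\mathbf u_h^{n,i},\xi_h^{n,i})\in\mathbf V_h\times W_h$ such that for all $(\mathbf v_h,\phi_h)\in\mathbf V_h\times W_h$ $$2\mu(\varepsilon(\mathbf u_h^{n,i}),\varepsilon(\mathbf v_h))-(\xi_h^{n,i},\operatorname{div}\mathbf v_h)=(\mathbf f,\mathbf v_h)+\langle\mathbf h,\mathbf v_h\rangle_{\Gamma_t},\qquad (\operatorname{div}\mathbf u_h^{n,i},\phi_h)+\tfrac1\lambda(\xi_h^{n,i},\phi_h)=\tfrac\alpha\lambda(p_h^{n,i},\phi_h).$$ *)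

(* Defs.v *)
From HB Require Import structures.
From mathcomp Require Import all_boot all_order all_algebra.
From mathcomp Require Import all_classical all_reals all_analysis.
Set Implicit Arguments.
Unset Strict Implicit.
Unset Printing Implicit Defensive.
Import Order.TTheory GRing.Theory Num.Theory.
Import numFieldNormedType.Exports.
Local Open Scope classical_set_scope.
Local Open Scope ring_scope.

(* 'rV[R]_d carries the product of the Borel sigma-algebras of R. *)
Definition measure_row_display : measure_display -> measure_display.
Proof. exact. Qed.

Section measurable_row.
Context {R : realType} (d : nat).

Definition coor (i : 'I_d) (x : 'rV[R]_d) : measurableTypeR R := x ord0 i.

Let row_set0 : g_sigma_preimage coor set0.
Proof. exact: sigma_algebra0. Qed.

Let row_setC A : g_sigma_preimage coor A -> g_sigma_preimage coor (~` A).
Proof. exact: sigma_algebraC. Qed.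

Let row_bigcup (F : (set 'rV[R]_d)^nat) :
  (forall i, g_sigma_preimage coor (F i)) ->
  g_sigma_preimage coor (\bigcup_i (F i)).
Proof. exact: sigma_algebra_bigcup. Qed.

HB.instance Definition _ :=
  @isMeasurable.Build (measure_row_display default_measure_display) 'rV[R]_d
    (g_sigma_preimage coor) row_set0 row_setC row_bigcup.

Lemma measurable_coor (i : 'I_d) : measurable_fun [set: 'rV[R]_d] (coor i).
Proof.
move=> _ Y mY; rewrite setTI; apply: sub_sigma_algebra => /=.
rewrite -bigcup_seq/=; exists i => /=; first by rewrite mem_index_enum.
by exists Y => //; rewrite setTI.
Qed.

Lemma measurable_fun_row d0 (T : measurableType d0) (f : T -> 'rV[R]_d) :
  (forall i, measurable_fun [set: T] (coor i \o f)) -> measurable_fun [set: T] f.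
Proof.
move=> mf; have : g_sigma_preimage (fun i => coor i \o f) `<=` measurable.
  apply: smallest_sub; first exact: sigma_algebra_measurable.
  rewrite -bigcup_seq; apply: bigcup_sub => i _ A [B mB <-].
  exact: mf.
rewrite g_sigma_preimage_comp => prefS _ A mA.
by apply: prefS; exists A.
Qed.

End measurable_row.

Section lebesgue_row.
Context {R : realType}.

Definition cons_row d (p : measurableTypeR R * 'rV[R]_d) : 'rV[R]_d.+1 :=
  \row_i (if unlift ord0 i is Some j then p.2 ord0 j else p.1).

Definition uncons_row d (x : 'rV[R]_d.+1) : measurableTypeR R * 'rV[R]_d :=
  (x ord0 ord0, \row_j x ord0 (lift ord0 j)).

Lemma cons_rowK d : cancel (@cons_row d) (@uncons_row d).
Proof.
move=> [a x]; rewrite /uncons_row /cons_row mxE unlift_none; congr pair.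
by apply/rowP => j; rewrite !mxE liftK.
Qed.

Lemma measurable_cons_row d : measurable_fun setT (@cons_row d).
Proof.
apply: measurable_fun_row => i.
rewrite (_ : _ \o _ = fun p : measurableTypeR R * 'rV[R]_d =>
    if unlift ord0 i is Some j then coor j p.2 else p.1); last first.
  by apply/funext => p; rewrite /coor /cons_row /= mxE.
case: unlift => [j|]; last exact: measurable_fst.
by apply: measurableT_comp; [exact: measurable_coor|exact: measurable_snd].
Qed.

Lemma measurable_uncons_row d : measurable_fun setT (@uncons_row d).
Proof.
apply/measurable_fun_pairP; split; first exact: (measurable_coor ord0).
apply: measurable_fun_row => i.
rewrite (_ : _ \o _ = coor (lift ord0 i)); first exact: measurable_coor.
by apply/funext => x; rewrite /coor /= mxE.
Qed.

Section step.
Context d (m : {sigma_finite_measure set 'rV[R]_d -> \bar R}).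
Local Open Scope ereal_scope.

Definition lebesgue_row_step : set 'rV[R]_d.+1 -> \bar R :=
  pushforward (@lebesgue_measure R \x m) (@cons_row d).

Let step0 : lebesgue_row_step set0 = 0.
Proof. by rewrite /lebesgue_row_step /pushforward preimage_set0 measure0. Qed.

Let step_ge0 A : 0 <= lebesgue_row_step A.
Proof. exact: (measure_ge0 (@lebesgue_measure R \x m)). Qed.

Let step_sigma_additive : semi_sigma_additive lebesgue_row_step.
Proof.
move=> F mF tF mUF; rewrite /lebesgue_row_step /pushforward preimage_bigcup.
have mpre A : measurable A -> measurable (@cons_row d @^-1` A).
  by move=> mA; rewrite -[X in measurable X]setTI; exact: measurable_cons_row.
apply: measure_semi_sigma_additive => [n||]; first exact: mpre.
  apply/trivIsetP => /= i j _ _ ij; rewrite -preimage_setI.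
  by move/trivIsetP : tF => /(_ _ _ _ _ ij) ->//; rewrite preimage_set0.
by rewrite -preimage_bigcup; exact: mpre.
Qed.

HB.instance Definition _ := isMeasure.Build _ _ _
  lebesgue_row_step step0 step_ge0 step_sigma_additive.

Let step_sigma_finite : sigma_finite setT lebesgue_row_step.
Proof.
have [F TF Foo] : sigma_finite setT (@lebesgue_measure R \x m).
  have /sigma_finiteP[F [TF ndF Foo]] := sigma_finiteT (@lebesgue_measure R).
  have /sigma_finiteP[G [TG ndG Goo]] := sigma_finiteT m.
  exists (fun n => F n `*` G n).
    rewrite -setXTT TF TG predeqE => -[x y]; split.
      move=> [/= [n _ Fnx] [k _ Gky]]; exists (maxn n k) => //; split.
      - by move: x Fnx; exact/subsetPset/ndF/leq_maxl.
      - by move: y Gky; exact/subsetPset/ndG/leq_maxr.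
    by move=> [n _ []/= ? ?]; split; exists n.
  move=> k; have [? ?] := Foo k; have [? ?] := Goo k.
  split; first exact: measurableX.
  by rewrite product_measure1E// lte_mul_pinfty// ge0_fin_numE.
exists (fun n => @uncons_row d @^-1` F n).
  by rewrite -preimage_bigcup -TF preimage_setT.
move=> n; have [mF Fn] := Foo n; split.
  by rewrite -[X in measurable X]setTI; exact: measurable_uncons_row.
rewrite /lebesgue_row_step /pushforward -comp_preimage.
rewrite (_ : _ \o _ = id) ?preimage_id//.
by apply/funext => p /=; rewrite cons_rowK.
Qed.

HB.instance Definition _ := Measure_isSigmaFinite.Build _ _ _
  lebesgue_row_step step_sigma_finite.

End step.

(* d-dimensional Lebesgue measure: iterated product of [lebesgue_measure],
   transported along R * R^d ~ R^d.+1. *)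
Fixpoint lebesgue_row d : {sigma_finite_measure set 'rV[R]_d -> \bar R} :=
  match d with
  | 0%N => \d_(0%R : 'rV[R]_0)
  | d'.+1 => lebesgue_row_step (lebesgue_row d')
  end.

End lebesgue_row.

Section surface.
Context {R : realType}.
Local Open Scope ereal_scope.

(* The norm carried by 'rV[R]_d is the sup norm. *)
Definition euclid_dist d (x y : 'rV[R]_d) : R :=
  Num.sqrt (\sum_i (x ord0 i - y ord0 i) ^+ 2)%R.

Definition diameter d (A : set 'rV[R]_d) : \bar R :=
  ereal_sup [set (euclid_dist x y)%:E | x in A & y in A].

(* The factor is the volume of the Euclidean ball of diameter 1 in R^s, so that
   the s-dimensional Hausdorff measure below is the usual s-dimensional area. *)
Definition hausdorff_gauge (s d : nat) (delta : R) (A : set 'rV[R]_d) : \bar R :=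
  if `[< A = set0 >] then 0
  else if diameter A <= delta%:E then
    lebesgue_row s [set x | (euclid_dist x 0 <= 2^-1)%R] * diameter A ^+ s
  else +oo.

Lemma hausdorff_gauge0 s d delta : @hausdorff_gauge s d delta set0 = 0.
Proof. by rewrite /hausdorff_gauge asboolT. Qed.

Lemma hausdorff_gauge_ge0 s d delta A : 0 <= @hausdorff_gauge s d delta A.
Proof.
rewrite /hausdorff_gauge; case: asboolP => // /eqP/set0P[x Ax].
case: ifPn => // _; apply: mule_ge0; first exact: measure_ge0.
apply: expe_ge0; apply: le_trans (ereal_sup_ubound _); last first.
  by exists x => //; exists x.
by rewrite lee_fin sqrtr_ge0.
Qed.

(* [mu_ext] uses covers by Borel sets, which is no restriction since a set and
   its closure have the same diameter. *)
Definition hausdorff (s d : nat) (A : set 'rV[R]_d) : \bar R :=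
  ereal_sup [set mu_ext (hausdorff_gauge s delta) A
            | delta in [set delta : R | (0 < delta)%R]].

Section outer.
Context (s d : nat).
Let h0 delta := @hausdorff_gauge0 s d delta.
Let hge0 delta := @hausdorff_gauge_ge0 s d delta.

Let hausdorff_ge0 A : 0 <= @hausdorff s d A.
Proof.
apply: le_trans (ereal_sup_ubound _); last by exists 1%R => //=.
exact/mu_ext_ge0/hge0.
Qed.

Let hausdorff0 : @hausdorff s d set0 = 0.
Proof.
apply/eqP; rewrite eq_le hausdorff_ge0 andbT.
apply: ge_ereal_sup => _ [delta _ <-].
by rewrite (mu_ext0 (h0 delta) (hge0 delta)).
Qed.

Let le_hausdorff : {homo @hausdorff s d : A B / A `<=` B >-> A <= B}.
Proof.
move=> A B AB; apply: ge_ereal_sup => _ [delta delta0 <-].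
apply: le_trans (ereal_sup_ubound _); last by exists delta.
exact: le_mu_ext.
Qed.

Let hausdorff_sigma_subadditive : sigma_subadditive (@hausdorff s d).
Proof.
move=> F; apply: ge_ereal_sup => _ [delta delta0 <-].
apply: (le_trans (mu_ext_sigma_subadditive (hge0 delta) F)).
apply: lee_nneseries => n *; first exact/mu_ext_ge0/hge0.
by apply: ereal_sup_ubound; exists delta.
Qed.

HB.instance Definition _ := isOuterMeasure.Build R 'rV[R]_d (@hausdorff s d)
  hausdorff0 hausdorff_ge0 le_hausdorff hausdorff_sigma_subadditive.

End outer.


(* Surface measure on hypersurfaces of R^d: the (d-1)-dimensional Hausdorff
   measure on its Caratheodory sigma-algebra. *)
Definition surface_outer d : {outer_measure set 'rV[R]_d -> \bar R} :=
  @hausdorff d.-1 d.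

Definition surface_measure d :
  set (caratheodory_type (surface_outer d)) -> \bar R := surface_outer d.

HB.instance Definition _ d := isMeasure.Build _ _ _ (@surface_measure d)
  (@caratheodory_measure0 R 'rV[R]_d (surface_outer d))
  (@caratheodory_measure_ge0 R 'rV[R]_d (surface_outer d))
  (@caratheodory_measure_sigma_additive R 'rV[R]_d (surface_outer d)).

End surface.

Section geometry.
Context {R : realType}.

(* The rows of V are the vertices. *)
Definition face m d (V : 'M[R]_(m, d)) (I : {set 'I_m}) : set 'rV[R]_d :=
  [set x | exists w : 'rV[R]_m,
    [/\ forall i, 0 <= w ord0 i, forall i, i \notin I -> w ord0 i = 0,
        \sum_i w ord0 i = 1 & x = w *m V]].

Definition simplex m d (V : 'M[R]_(m, d)) : set 'rV[R]_d :=
  face V [set: 'I_m]%SET.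

Definition affinely_independent m d (V : 'M[R]_(m, d)) : Prop :=
  forall w : 'rV[R]_m, \sum_i w ord0 i = 0 -> w *m V = 0 -> w = 0.

Definition boundary d (A : set 'rV[R]_d) : set 'rV[R]_d := closure A `\` A°.

(* Bounded domain whose boundary is a finite union of nondegenerate
   (d-1)-simplices (segments if d = 2, triangles if d = 3). *)
Definition polyhedral_domain d (Om : set 'rV[R]_d) : Prop :=
  [/\ open Om, connected Om, Om !=set0, bounded_set Om &
    exists F : seq 'M[R]_(d, d),
      (forall V, V \in F -> affinely_independent V) /\
      boundary Om = \bigcup_(V in [set` F]) simplex V].

Definition triangulation d (Om : set 'rV[R]_d) (Th : seq 'M[R]_(d.+1, d)) :
    Prop :=
  [/\ forall V, V \in Th -> affinely_independent V,
      closure Om = \bigcup_(V in [set` Th]) simplex V,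
      forall V, V \in Th -> (simplex V)° `<=` Om &
      forall V W, V \in Th -> W \in Th -> exists I J : {set 'I_d.+1},
        simplex V `&` simplex W = face V I /\
        simplex V `&` simplex W = face W J].

End geometry.

Section finite_elements.
Context {R : realType} {d : nat}.
Implicit Types (Om G : set 'rV[R]_d) (Th : seq 'M[R]_(d.+1, d)).

(* f is a polynomial of total degree at most k on A. *)
Definition polynomial_on k (A : set 'rV[R]_d) (f : 'rV[R]_d -> R) : Prop :=
  exists c : {ffun 'I_d -> 'I_k.+1} -> R, forall x, A x ->
    f x = \sum_(a : {ffun 'I_d -> 'I_k.+1} | (\sum_i a i <= k)%N)
            c a * \prod_i x ord0 i ^+ a i.

(* Functions on the closure of Om are represented by functions on R^d; their
   values outside the closure play no role. *)
Definition Vh Om Gd Th (v : 'rV[R]_d -> 'rV[R]_d) : Prop :=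
  [/\ {within closure Om, continuous v}, forall x, Gd x -> v x = 0 &
      forall V, V \in Th -> forall i,
        polynomial_on 2 (simplex V) (fun x => v x ord0 i)].

Definition Wh Om Th (phi : 'rV[R]_d -> R) : Prop :=
  {within closure Om, continuous phi} /\
  (forall V, V \in Th -> polynomial_on 1 (simplex V) phi).

Definition Mh Om Gp Th (psi : 'rV[R]_d -> R) : Prop :=
  [/\ {within closure Om, continuous psi}, forall x, Gp x -> psi x = 0 &
      forall V, V \in Th -> polynomial_on 1 (simplex V) psi].

(* Partial derivative of a finite element function: classical inside each
   element, and 0 by convention on the mesh skeleton (a null set). *)
Definition mesh_partial Th (f : 'rV[R]_d -> R) (j : 'I_d) (x : 'rV[R]_d) : R :=
  if `[< exists2 V, V \in Th & (simplex V)° x >]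
  then 'D_(delta_mx ord0 j) f x else 0.

Definition gradient Th (p : 'rV[R]_d -> R) (x : 'rV[R]_d) : 'rV[R]_d :=
  \row_j mesh_partial Th p j x.

Definition vgradient Th (u : 'rV[R]_d -> 'rV[R]_d) (x : 'rV[R]_d) : 'M[R]_d :=
  \matrix_(i, j) mesh_partial Th (fun y => u y ord0 i) j x.

Definition divergence Th (u : 'rV[R]_d -> 'rV[R]_d) (x : 'rV[R]_d) : R :=
  \tr (vgradient Th u x).

Definition strain Th (u : 'rV[R]_d -> 'rV[R]_d) (x : 'rV[R]_d) : 'M[R]_d :=
  2^-1 *: (vgradient Th u x + (vgradient Th u x)^T).

Definition mxdot m n (A B : 'M[R]_(m, n)) : R :=
  \sum_i \sum_j A i j * B i j.

Definition inner Om (f g : 'rV[R]_d -> R) : R :=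
  \int[lebesgue_row d]_(x in Om) (f x * g x).

Definition inner_mx m n Om (A B : 'rV[R]_d -> 'M[R]_(m, n)) : R :=
  \int[lebesgue_row d]_(x in Om) mxdot (A x) (B x).

Definition inner_bd G (f g : 'rV[R]_d -> R) : R :=
  \int[@surface_measure R d]_(x in G) (f x * g x).

Definition inner_bd_mx m n G (A B : 'rV[R]_d -> 'M[R]_(m, n)) : R :=
  \int[@surface_measure R d]_(x in G) mxdot (A x) (B x).

(* Extended-real valued, so that no finiteness is presupposed. *)
Definition L2norm Om (f : 'rV[R]_d -> R) : \bar R :=
  'N[lebesgue_row d]_2%:E [EFin \o (f \_ Om)].

Definition L2norm_mx m n Om (A : 'rV[R]_d -> 'M[R]_(m, n)) : \bar R :=
  L2norm Om (fun x => Num.sqrt (mxdot (A x) (A x))).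

Definition surface_measurable (G : set 'rV[R]_d) : Prop :=
  (surface_outer d).-caratheodory G.

End finite_elements.

Definition square_integrable (R : realType) (disp : measure_display)
    (T : measurableType disp) (m : {measure set T -> \bar R})
    (D : set T) (f : T -> R) : Prop :=
  measurable_fun D f /\ m.-integrable D (fun x => (f x ^+ 2)%:E).

Definition L2_domain (R : realType) d (Om : set 'rV[R]_d) (f : 'rV[R]_d -> R) :=
  square_integrable (lebesgue_row d) Om f.

Definition L2_boundary (R : realType) d (G : set 'rV[R]_d) (f : 'rV[R]_d -> R) :=
  square_integrable (@surface_measure R d) G f.

(* Main.v *)
(** Subtracting the two algorithms, the errors satisfy, with [a = alpha / lambda]
    and [c = c0 + alpha ^ 2 / lambda],
      c (e_p^i, psi) + K dt (grad e_p^i, grad psi) = a (e_xi^(i-1), psi),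
      2 mu (eps e_u^i, eps v) = (e_xi^i, div v),
      (div e_u^i, phi) + (e_xi^i, phi) / lambda = a (e_p^i, phi).
    Testing with the errors themselves and using Young's inequality gives
      |e_p^i|^2 <= (a / c)^2 |e_xi^(i-1)|^2,
      4 mu lambda |eps e_u^i|^2 + |e_xi^i|^2 <= alpha^2 |e_p^i|^2,
    so that |e_xi^i|^2 contracts by the factor (alpha a / c)^2, which is less
    than 1 because c0 > 0.  All the integrals are finite because finite element functions and
    their elementwise derivatives are bounded and Borel measurable on the
    bounded open set [Om]. *)

Require Import Defs.
From mathcomp Require Import all_boot all_order all_algebra.
From mathcomp Require Import all_classical all_reals all_analysis.
From mathcomp Require Import measurable_realfun ring lra.
Set Implicit Arguments.
Unset Strict Implicit.
Unset Printing Implicit Defensive.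
Import Order.TTheory GRing.Theory Num.Theory.
Import numFieldNormedType.Exports.
Local Open Scope classical_set_scope.
Local Open Scope ring_scope.

(** * Borel sets for the product sigma-algebra on rows *)

Section opens.
Context {R : realType} {d : nat}.

(** A ball of the sup norm is a finite intersection of coordinate preimages of intervals. Radii that
    are not positive are split off because there the ball is empty, whereas for [d = 0] that
    intersection is the whole space. *)
Lemma measurable_row_ball (x : 'rV[R]_d) (e : R) : measurable (ball x e).
Proof.
have [e0|e0] := ltP 0 e; last first.
  rewrite (_ : ball x e = set0) ?measurable0 //.
  by rewrite predeqE => y; split => // -[]; rewrite ltNge e0.
rewrite (_ : ball x e =
    \bigcap_(i in [set: 'I_d]) (setT `&` coor i @^-1` (ball (x ord0 i) e))).
  apply: fin_bigcap_measurable => [|i _]; first exact: finite_finset.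
  by apply: measurable_coor => //; exact: measurable_ball.
rewrite predeqE => y; split => [[_ xy] i _|xy]; first by split => //; exact: xy.
by split=> // i j; rewrite (ord1 i); have [_] := xy j I.
Qed.

(** The sigma-algebra is generated by coordinates, not by open sets; the link is that an open set is
    the countable union of the balls inside it that have a rational centre and a radius
    [k.+1%:R^-1]. *)
Lemma open_measurable_row (U : set 'rV[R]_d) : open U -> measurable U.
Proof.
move=> oU.
pose Bq (qk : 'rV[rat]_d * nat) : set 'rV[R]_d :=
  ball (map_mx ratr qk.1 : 'rV[R]_d) (qk.2.+1%:R^-1 : R).
rewrite (_ : U = \bigcup_qk (if `[< Bq qk `<=` U >] then Bq qk else set0)).
  apply: countable_bigcupT_measurable; first exact: countableP.
  move=> qk; case: asboolP => _; first exact: measurable_row_ball.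
  exact: measurable0.
rewrite predeqE => x; split=> [Ux|[qk _]]; last by case: asboolP => // /[apply].
have /nbhs_ballP[e /= e0 xeU] : nbhs x U by exact: open_nbhs_nbhs.
(* With radius below [e / 2] and a rational centre closer to [x] than that radius, the ball contains
   [x] and, by the triangle inequality, stays inside [ball x e]. *)
have [k k0] : exists k : nat, k.+1%:R^-1 < e / 2.
  have [k _ /(_ _ (leqnn k))] :=
    near_infty_natSinv_lt (PosNum (divr_gt0 e0 (ltr0Sn R 1))).
  by exists k.
set r : R := k.+1%:R^-1 in k0.
have r0 : 0 < r by rewrite /r invr_gt0.
have /choice[q qP] : forall i : 'I_d, exists q : rat, ratr q \in `]x ord0 i - r, x ord0 i + r[.
  by move=> i; apply: rat_in_itvoo; lra.
have qx : ball (map_mx ratr (\row_i q i) : 'rV[R]_d) r x.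
  split => // i j; rewrite (ord1 i) !mxE /ball /= ltr_norml.
  by have := qP j; rewrite in_itv /=; lra.
exists (\row_i q i, k) => //; case: asboolP => // -[]; rewrite /Bq /= -/r.
move=> y qy; apply: xeU.
have -> : e = e / 2 + e / 2 by lra.
apply: ball_triangle (le_ball (ltW k0) qy).
exact/ball_sym/(le_ball (ltW k0)).
Qed.

End opens.

(** * Bounded measurable sets have finite Lebesgue measure *)

Section box.
Context {R : realType}.

Lemma measurable_row_box d (M : R) :
  measurable [set x : 'rV[R]_d | forall i, `|x ord0 i| <= M].
Proof.
rewrite (_ : mkset _ = \bigcap_(i in [set: 'I_d]) (setT `&` coor i @^-1` `[(- M), M])).
  apply: fin_bigcap_measurable => [|i _]; first exact: finite_finset.
  exact: measurable_coor.
rewrite predeqE => x; split => [xM i _|xM i].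
  by split=> //=; rewrite in_itv /= -ler_norml; exact: xM.
by have [_] := xM i I; rewrite /= in_itv /= -ler_norml.
Qed.

(** Induction on [d]: [cons_row] pulls the cube back to an interval times the lower-dimensional
    cube, and the product measure of this rectangle is a product of finite measures. *)
Lemma lebesgue_row_box d (M : R) :
  (lebesgue_row d [set x : 'rV[R]_d | forall i, `|x ord0 i| <= M]%R < +oo)%E.
Proof.
elim: d => [|d IH] /=.
  rewrite diracE; exact: ltry.
rewrite /lebesgue_row_step /pushforward.
have mbox := @measurable_row_box d M.
rewrite (_ : _ @^-1` _ = `[(- M), M] `*` [set x : 'rV[R]_d | forall i, `|x ord0 i| <= M]).
  rewrite product_measure1E//= lte_mul_pinfty//.
  by rewrite lebesgue_measure_itv /=; case: ifP => _; rewrite -?EFinB.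
rewrite predeqE => -[a x]; split => /=.
  move=> H; split; first by have := H ord0; rewrite mxE unlift_none in_itv /= -ler_norml.
  by move=> i; have := H (lift ord0 i); rewrite mxE liftK.
rewrite in_itv /= -ler_norml => -[aM xM] i; rewrite mxE.
by case: unliftP => [j _|_] //.
Qed.

Lemma bounded_row d (A : set 'rV[R]_d) : bounded_set A ->
  exists M, forall x, A x -> forall i, `|x ord0 i| <= M.
Proof.
move=> /pinfty_ex_gt0[M _ AM]; exists M => x Ax i.
apply: le_trans (AM _ Ax); rewrite /Num.norm /= mx_normrE.
exact: (le_bigmax _ (fun ij : 'I_1 * 'I_d => `|x ij.1 ij.2|) (ord0, i)).
Qed.

Lemma bounded_lebesgue_row d (A : set 'rV[R]_d) : measurable A ->
  bounded_set A -> (lebesgue_row d A < +oo)%E.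
Proof.
move=> mA /bounded_row[M AM]; apply: le_lt_trans (lebesgue_row_box d M).
by apply: le_measure; rewrite ?inE//; exact: measurable_row_box.
Qed.

End box.

(** * An algebra of integrable functions *)

Section bounded_measurable.
Context {R : realType} {disp : measure_display} {T : measurableType disp}.
Implicit Types (D : set T) (f g : T -> R).

(** This class is stable under sums and products, unlike integrability, so on a set of finite
    measure it settles every integrability condition on products of finite element functions. *)
Definition bounded_measurable D f : Prop :=
  measurable_fun D f /\ exists M, forall x, D x -> `|f x| <= M.

Lemma bounded_measurable_cst D (c : R) : bounded_measurable D (fun=> c).
Proof. by split; [exact: measurable_cst|exists `|c|]. Qed.

Lemma bounded_measurableD D f g : bounded_measurable D f ->
  bounded_measurable D g -> bounded_measurable D (fun x => f x + g x).
Proof.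
move=> [mf [M fM]] [mg [N gN]]; split; first exact: measurable_funD.
exists (M + N) => x Dx; apply: le_trans (ler_normD _ _) _.
by apply: lerD; [exact: fM|exact: gN].
Qed.

Lemma bounded_measurableM D f g : bounded_measurable D f ->
  bounded_measurable D g -> bounded_measurable D (fun x => f x * g x).
Proof.
move=> [mf [M fM]] [mg [N gN]]; split; first exact: measurable_funM.
exists (M * N) => x Dx; rewrite normrM.
by apply: ler_pM => //; [exact: fM|exact: gN].
Qed.

Lemma bounded_measurableZ D c f : bounded_measurable D f ->
  bounded_measurable D (fun x => c * f x).
Proof. by move=> bf; apply: bounded_measurableM => //; exact: bounded_measurable_cst. Qed.

Lemma bounded_measurable_sum D (I : Type) (r : seq I) (F : I -> T -> R) :
  (forall i, bounded_measurable D (F i)) ->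
  bounded_measurable D (fun x => \sum_(i <- r) F i x).
Proof.
move=> bF; elim: r => [|i r IH].
  under eq_fun do rewrite big_nil.
  exact: bounded_measurable_cst.
by under eq_fun do rewrite big_cons; exact: bounded_measurableD.
Qed.

Lemma bounded_measurable_mxdot D m n (A B : T -> 'M[R]_(m, n)) :
  (forall i j, bounded_measurable D (fun x => A x i j)) ->
  (forall i j, bounded_measurable D (fun x => B x i j)) ->
  bounded_measurable D (fun x => mxdot (A x) (B x)).
Proof.
move=> bA bB; apply: bounded_measurable_sum => i; apply: bounded_measurable_sum => j.
exact: bounded_measurableM.
Qed.

Lemma bounded_measurable_integrable (m : {measure set T -> \bar R}) D f :
  measurable D -> (m D < +oo)%E -> bounded_measurable D f ->
  m.-integrable D (EFin \o f).
Proof.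
move=> mD Dfin [mf [M fM]]; apply: measurable_bounded_integrable => //.
exists M; split; first exact: num_real.
by move=> N /ltW MN x Dx; exact: le_trans (fM _ Dx) MN.
Qed.

End bounded_measurable.

(** * Polynomial functions and their derivatives *)

Section polyfun.
Context {R : realType} {d : nat}.

(** Polynomials as the algebra generated by constants and coordinates: boundedness, measurability
    and differentiation become inductions, with no handling of coefficients or degrees. *)
Inductive polyfun : ('rV[R]_d -> R) -> Prop :=
| polyfun_cst c : polyfun (fun=> c)
| polyfun_coord i : polyfun (fun x => x ord0 i)
| polyfunD f g : polyfun f -> polyfun g -> polyfun (fun x => f x + g x)
| polyfunM f g : polyfun f -> polyfun g -> polyfun (fun x => f x * g x).

Lemma polyfun_bounded_measurable (A : set 'rV[R]_d) f : bounded_set A -> polyfun f ->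
  bounded_measurable A f.
Proof.
move=> /bounded_row[M AM]; elim=> [c|i|{}f g _ bf _ bg|{}f g _ bf _ bg].
- exact: bounded_measurable_cst.
- split; last by exists M => x Ax; exact: AM.
  by apply: measurable_funTS; exact: (measurable_coor i).
- exact: bounded_measurableD.
- exact: bounded_measurableM.
Qed.

(** A coordinate is linear, so its difference quotient equals [v ord0 i] for every nonzero [h]. *)
Lemma is_derive_coord (x v : 'rV[R]_d) i :
  is_derive x v (fun y : 'rV[R]_d => y ord0 i) (v ord0 i).
Proof.
have H : h^-1 *: (((fun y : 'rV[R]_d => y ord0 i) \o shift x) (h *: v) - x ord0 i)
    @[h --> (0 : R)^'] --> v ord0 i.
  apply: cvg_near_cst; near=> h.
  by rewrite /= !mxE addrK scalerA mulVf ?scale1r//; near: h; exact: nbhs_dnbhs_neq.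
by split; [exact: cvgP H|exact/cvg_lim].
Unshelve. all: by end_near. Qed.

Lemma polyfun_derive (v : 'rV[R]_d) f : polyfun f ->
  exists2 g, polyfun g & forall x, is_derive x v f (g x).
Proof.
elim=> [c|i|{}f g pf [f' pf' df] pg [g' pg' dg]|{}f g pf [f' pf' df] pg [g' pg' dg]].
- by exists (fun=> 0) => [|x]; [exact: polyfun_cst|exact: is_derive_cst].
- exists (fun=> v ord0 i) => [|x]; first exact: polyfun_cst.
  exact: is_derive_coord.
- by exists (fun x => f' x + g' x) => [|x]; [exact: polyfunD|exact: is_deriveD].
- exists (fun x => f x * g' x + g x * f' x) => [|x]; last exact: is_deriveM.
  by apply: polyfunD; exact: polyfunM.
Qed.

Lemma polyfun_sum (I : Type) (r : seq I) (P : pred I) (F : I -> 'rV[R]_d -> R) :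
  (forall i, polyfun (F i)) -> polyfun (fun x => \sum_(i <- r | P i) F i x).
Proof.
move=> pF; elim: r => [|i r IH].
  by under eq_fun do rewrite big_nil; exact: polyfun_cst.
under eq_fun do rewrite big_cons; case: (P i) => //; exact: polyfunD.
Qed.

Lemma polyfun_prod (I : Type) (r : seq I) (F : I -> 'rV[R]_d -> R) :
  (forall i, polyfun (F i)) -> polyfun (fun x => \prod_(i <- r) F i x).
Proof.
move=> pF; elim: r => [|i r IH].
  by under eq_fun do rewrite big_nil; exact: polyfun_cst.
under eq_fun do rewrite big_cons; exact: polyfunM.
Qed.

Lemma polyfunX f k : polyfun f -> polyfun (fun x => f x ^+ k).
Proof.
move=> pf; elim: k => [|k IH]; first by under eq_fun do rewrite expr0; exact: polyfun_cst.
by under eq_fun do rewrite exprS; exact: polyfunM.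
Qed.

Lemma polynomial_on_polyfun k A (f : 'rV[R]_d -> R) : polynomial_on k A f ->
  exists2 P, polyfun P & forall x, A x -> f x = P x.
Proof.
move=> [c fc]; eexists; last exact: fc.
apply: polyfun_sum => a; apply: polyfunM; first exact: polyfun_cst.
by apply: polyfun_prod => i; apply: polyfunX; exact: polyfun_coord.
Qed.

Lemma polynomial_onB k A (f g : 'rV[R]_d -> R) : polynomial_on k A f ->
  polynomial_on k A g -> polynomial_on k A (fun x => f x - g x).
Proof.
move=> [a fa] [b gb]; exists (fun i => a i - b i) => x Ax.
rewrite fa // gb // -sumrB; apply: eq_bigr => i _; by rewrite mulrBl.
Qed.

(** Differentiation is local: near an interior point of [A], [f] coincides with a polynomial,
    whatever its values outside [A]. *)
Lemma polynomial_on_is_derive k A (f : 'rV[R]_d -> R) v : polynomial_on k A f ->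
  exists2 g, polyfun g & forall x, A° x -> is_derive x v f (g x).
Proof.
move=> /polynomial_on_polyfun[P /(polyfun_derive v)[g pg dP] fP].
exists g => // x Ax; have fPx : {near x, P =1 f}.
  by apply: filterS Ax => y /fP.
have [dPx <-] := dP x; split; first exact: near_eq_derivable fPx dPx.
by apply/esym/near_eq_derive.
Qed.

End polyfun.

(** * Finite element functions and their elementwise derivatives *)

Section mesh.
Context {R : realType} {d : nat}.
Implicit Types (Om : set 'rV[R]_d) (Th : seq 'M[R]_(d.+1, d)).

Lemma bounded_on_seq (I : eqType) (T : Type) (s : seq I) (F : I -> set T) (f : T -> R) :
  (forall i, i \in s -> exists M, forall x, F i x -> `|f x| <= M) ->
  exists M, forall i x, i \in s -> F i x -> `|f x| <= M.
Proof.
elim: s => [|i s IH] H; first by exists 0.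
have [M sM] := IH (fun j js => H j (mem_behead (s := i :: s) js)).
have [N iN] := H i (mem_head i s).
exists (Num.max N M) => j x; rewrite inE le_max => /predU1P[->|js] Fx.
  by rewrite iN.
by rewrite (sM j) ?orbT.
Qed.

Lemma measurable_fun_fin_bigcup (d1 d2 : measure_display) (T1 : measurableType d1)
    (T2 : measurableType d2) (I : Type) (s : set I) (F : I -> set T1) (f : T1 -> T2) :
  finite_set s -> (forall i, s i -> measurable (F i)) ->
  (forall i, s i -> measurable_fun (F i) f) ->
  measurable_fun (\bigcup_(i in s) F i) f.
Proof.
move=> fs mF mf _ Y mY; rewrite setI_bigcupl.
by apply: fin_bigcup_measurable => // i si; apply: mf => //; exact: mF.
Qed.

Lemma sub_bounded_row (A B : set 'rV[R]_d) : A `<=` B -> bounded_set B -> bounded_set A.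
Proof.
move=> AB [M [Mr BM]]; exists M; split => // N MN x /AB; exact: BM.
Qed.

(** [Om] splits into [S], a finite union of open element interiors on each of which the derivative
    is a polynomial, and the remaining skeleton, where [mesh_partial] is 0 by convention. *)
Lemma mesh_partial_bounded_measurable k Om Th f j : measurable Om -> bounded_set Om ->
  (forall V, V \in Th -> (simplex V)° `<=` Om) ->
  (forall V, V \in Th -> polynomial_on k (simplex V) f) ->
  bounded_measurable Om (mesh_partial Th f j).
Proof.
move=> mOm bOm ThOm pf; pose v : 'rV[R]_d := delta_mx ord0 j.
pose S := \bigcup_(V in [set` Th]) (simplex V)°.
have dP V : V \in Th -> exists2 g, polyfun g &
    forall x, (simplex V)° x -> mesh_partial Th f j x = g x.
  move=> VTh; have [g pg gP] := polynomial_on_is_derive v (pf _ VTh).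
  exists g => // x Vx; rewrite /mesh_partial asboolT; last by exists V.
  by have [_] := gP _ Vx.
have S0 x : ~ S x -> mesh_partial Th f j x = 0.
  by move=> nSx; rewrite /mesh_partial asboolF // => -[V VTh Vx]; apply: nSx; exists V.
have bV V : V \in Th -> bounded_measurable (simplex V)° (mesh_partial Th f j).
  move=> VTh; have [g pg gP] := dP _ VTh.
  have [mg [M gM]] := polyfun_bounded_measurable (sub_bounded_row (ThOm V VTh) bOm) pg.
  split; last by exists M => x Vx; rewrite gP // gM.
  by apply: eq_measurable_fun mg => x /set_mem Vx; rewrite gP.
split.
  have mS : measurable S.
    apply: fin_bigcup_measurable => [|V _]; first exact: finite_seq.
    by apply: open_measurable_row; exact: open_interior.
  rewrite (_ : Om = S `|` (Om `\` S)); last first.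
    by rewrite setDUK // => x [V VTh]; exact: ThOm.
  apply/measurable_funU => //; first exact: measurableD.
  split.
    apply: measurable_fun_fin_bigcup => [|V _|V VTh]; first exact: finite_seq.
      by apply: open_measurable_row; exact: open_interior.
    exact: (bV V VTh).1.
  apply: (eq_measurable_fun (fun=> 0 : R)); last exact: measurable_cst.
  by move=> x /set_mem[_ /S0 ->].
have [M MP] := bounded_on_seq (F := fun V => (simplex V)°) (fun V VTh => (bV V VTh).2).
(* [M] bounds the derivative on [S] only and may be negative if [S] is empty; the maximum with 0
   covers the skeleton. *)
exists (Num.max M 0) => x _; rewrite le_max.
have [[V VTh Vx]|/S0 ->] := pselect (S x); first by rewrite (MP V).
by rewrite normr0 lexx orbT.
Qed.

(** Inside an element both functions are differentiable, so the derivative is additive; on the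
    skeleton all three terms are 0. Hence the identity holds at every point, not just almost
    everywhere. *)
Lemma mesh_partialB k Th f g j x :
  (forall V, V \in Th -> polynomial_on k (simplex V) f) ->
  (forall V, V \in Th -> polynomial_on k (simplex V) g) ->
  mesh_partial Th (fun y => f y - g y) j x
    = mesh_partial Th f j x - mesh_partial Th g j x.
Proof.
move=> pf pg; rewrite /mesh_partial; case: asboolP => [[V VTh Vx]|_]; last by rewrite subr0.
have [f' _ /(_ _ Vx) [df _]] := polynomial_on_is_derive (delta_mx ord0 j) (pf _ VTh).
have [g' _ /(_ _ Vx) [dg _]] := polynomial_on_is_derive (delta_mx ord0 j) (pg _ VTh).
exact: deriveB.
Qed.

Lemma within_continuous_measurable Om (f : 'rV[R]_d -> R) : open Om ->
  {within closure Om, continuous f} -> measurable_fun Om f.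
Proof.
move=> oOm /(continuous_subspaceW (@subset_closure _ Om)).
rewrite (continuous_open_subspace _ oOm) => /(continuous_inP _ oOm) cf.
move=> mOm; apply: (measurability _ (RGenOpens.measurableE R)) => //.
move=> _ [_ [a [b ->] <-]]; apply: open_measurable_row.
exact/cf/interval_open.
Qed.

(** Measurability comes from continuity on the open set [Om], the bound from the finitely many
    polynomial pieces whose simplices cover it. *)
Lemma fe_bounded_measurable k Om Th (f : 'rV[R]_d -> R) : open Om -> bounded_set Om ->
  closure Om = \bigcup_(V in [set` Th]) simplex V ->
  {within closure Om, continuous f} ->
  (forall V, V \in Th -> polynomial_on k (simplex V) f) ->
  bounded_measurable Om f.
Proof.
move=> oOm bOm cOm cf pf; split; first exact: within_continuous_measurable.
have [|M MP] := @bounded_on_seq _ _ Th (fun V => Om `&` simplex V) f.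
  move=> V VTh; have [P pP fP] := polynomial_on_polyfun (pf _ VTh).
  have [_ [M PM]] := polyfun_bounded_measurable bOm pP.
  by exists M => x [Omx Vx]; rewrite fP // PM.
exists M => x Omx; have := subset_closure Omx; rewrite cOm => -[V VTh Vx].
exact: MP VTh _.
Qed.

Lemma within_continuousB (V : normedModType R) (A : set 'rV[R]_d) (f g : 'rV[R]_d -> V) :
  {within A, continuous f} -> {within A, continuous g} ->
  {within A, continuous (fun x => f x - g x)}.
Proof. by move=> cf cg x; apply: cvgB; [exact: cf|exact: cg]. Qed.

(** With its two analogues below, this makes the errors admissible test functions. *)
Lemma WhB Om Th f g : Wh Om Th f -> Wh Om Th g -> Wh Om Th (fun x => f x - g x).
Proof.
move=> [cf pf] [cg pg]; split; first exact: within_continuousB.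
by move=> V VTh; apply: polynomial_onB; [exact: pf|exact: pg].
Qed.

Lemma MhB Om G Th f g : Mh Om G Th f -> Mh Om G Th g -> Mh Om G Th (fun x => f x - g x).
Proof.
move=> [cf f0 pf] [cg g0 pg]; split; first exact: within_continuousB.
  by move=> x Gx; rewrite f0 // g0 // subr0.
by move=> V VTh; apply: polynomial_onB; [exact: pf|exact: pg].
Qed.

Lemma VhB Om G Th f g : Vh Om G Th f -> Vh Om G Th g -> Vh Om G Th (fun x => f x - g x).
Proof.
move=> [cf f0 pf] [cg g0 pg]; split; first exact: within_continuousB.
  by move=> x Gx; rewrite f0 // g0 // subr0.
move=> V VTh i; have [c fc] := polynomial_onB (pf _ VTh i) (pg _ VTh i).
by exists c => x Vx; rewrite !mxE fc.
Qed.

End mesh.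

(** * Inner products and L2 norms of bounded measurable functions *)

Section inner_products.
Context {R : realType} {d : nat} (Om : set 'rV[R]_d).
Context (mOm : measurable Om) (Om_fin : (lebesgue_row d Om < +oo)%E).
Implicit Types f g h : 'rV[R]_d -> R.
Local Notation bm := (bounded_measurable Om).
Let int f : bm f -> (lebesgue_row d).-integrable Om (EFin \o f) :=
  bounded_measurable_integrable mOm Om_fin.

Lemma innerC f g : inner Om f g = inner Om g f.
Proof. by rewrite /inner; under eq_Rintegral do rewrite mulrC. Qed.

Lemma innerBl f g h : bm f -> bm g -> bm h ->
  inner Om (fun x => f x - g x) h = inner Om f h - inner Om g h.
Proof.
move=> bf bg bh; rewrite /inner -RintegralB//; last 2 first.
- exact/int/bounded_measurableM.
- exact/int/bounded_measurableM.
by under eq_Rintegral do rewrite mulrBl.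
Qed.

Lemma inner_ge0 f : 0 <= inner Om f f.
Proof. by apply: Rintegral_ge0 => x _; rewrite -expr2 sqr_ge0. Qed.

(** Integrate the pointwise inequality [0 <= (s * f x - g x) ^+ 2]. *)
Lemma inner_young s f g : bm f -> bm g ->
  2 * s * inner Om f g <= s ^+ 2 * inner Om f f + inner Om g g.
Proof.
move=> bf bg; have bff := bounded_measurableM bf bf.
have bgg := bounded_measurableM bg bg; have bfg := bounded_measurableM bf bg.
rewrite /inner -!RintegralZl -?RintegralD//; try exact: int; last first.
  exact/int/bounded_measurableZ.
apply: le_Rintegral => //.
- exact/int/bounded_measurableZ.
- exact/int/bounded_measurableD/bgg/bounded_measurableZ.
move=> x _; rewrite -subr_ge0.
by rewrite (_ : _ - _ = (s * f x - g x) ^+ 2) ?sqr_ge0//; ring.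
Qed.

Lemma inner_mxBl m n (A B C : 'rV[R]_d -> 'M[R]_(m, n)) :
  (forall i j, bm (fun x => A x i j)) -> (forall i j, bm (fun x => B x i j)) ->
  (forall i j, bm (fun x => C x i j)) ->
  inner_mx Om (fun x => A x - B x) C = inner_mx Om A C - inner_mx Om B C.
Proof.
move=> bA bB bC; rewrite /inner_mx -RintegralB//; last 2 first.
- exact/int/bounded_measurable_mxdot.
- exact/int/bounded_measurable_mxdot.
apply: eq_Rintegral => x _; rewrite /mxdot -sumrB; apply: eq_bigr => i _.
by rewrite -sumrB; apply: eq_bigr => j _; rewrite !mxE mulrBl.
Qed.

Lemma mxdot_ge0 m n (A : 'M[R]_(m, n)) : 0 <= mxdot A A.
Proof.
by apply: sumr_ge0 => i _; apply: sumr_ge0 => j _; rewrite -expr2 sqr_ge0.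
Qed.

Lemma inner_mx_ge0 m n (A : 'rV[R]_d -> 'M[R]_(m, n)) : 0 <= inner_mx Om A A.
Proof. by apply: Rintegral_ge0 => x _; exact: mxdot_ge0. Qed.

(** Passes from the extended-real norm to real inner products. The hypothesis bears on the square,
    which for the matrix norm in [L2norm_mxE] is simply [mxdot]. *)
Lemma L2normE f : (lebesgue_row d).-integrable Om (EFin \o (fun x => f x * f x)) ->
  L2norm Om f = (Num.sqrt (inner Om f f))%:E.
Proof.
move=> iff; rewrite /L2norm unlock /=.
rewrite (_ : (\int[_]_x _)%E = (inner Om f f)%:E); last first.
  rewrite /inner /Rintegral fineK; last exact: integrable_fin_num iff.
  (* The norm integrates over the whole space the function extended by 0 outside [Om], so the inner
     product is put in the same form. *)
  rewrite [RHS]integral_mkcond; apply: eq_integral => x _.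
  rewrite /= !patchE; case: ifP => _; rewrite /= ?normr0.
    by rewrite powR_mulrn// real_normK ?num_real// expr2.
  by rewrite powR0.
by rewrite poweR_EFin powR12_sqrt// inner_ge0.
Qed.

Lemma L2norm_mxE m n (A : 'rV[R]_d -> 'M[R]_(m, n)) :
  (forall i j, bm (fun x => A x i j)) ->
  L2norm_mx Om A = (Num.sqrt (inner_mx Om A A))%:E.
Proof.
move=> bA; have sqrtA x :
    Num.sqrt (mxdot (A x) (A x)) * Num.sqrt (mxdot (A x) (A x)) = mxdot (A x) (A x).
  by rewrite -expr2 sqr_sqrtr// mxdot_ge0.
rewrite /L2norm_mx L2normE.
  by rewrite /inner; under eq_Rintegral do rewrite sqrtA.
under eq_fun do rewrite sqrtA.
exact/int/bounded_measurable_mxdot.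
Qed.

End inner_products.

(** * Sequences tending to zero *)

Section limits.
Context {R : realType}.

Lemma squeeze_cvg0 (x y : nat -> R) : (forall i, 0 <= x i <= y i) ->
  y i @[i --> \oo] --> 0 -> x i @[i --> \oo] --> 0.
Proof.
move=> xy y0; apply: squeeze_cvgr y0; last exact: cvg_cst.
exact: nearW.
Qed.

(** By induction [x i] is at most [x 0%N * q ^+ i], a null geometric sequence. *)
Lemma contraction_cvg0 (q : R) (x : nat -> R) : 0 <= q < 1 ->
  (forall i, 0 <= x i) -> (forall i, x i.+1 <= q * x i) ->
  x i @[i --> \oo] --> 0.
Proof.
move=> /andP[q0 q1] x0 xq; apply: (squeeze_cvg0 (y := geometric (x 0%N) q)).
  move=> i; rewrite x0 /=; elim: i => [|i IH]; first by rewrite expr0 mulr1.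
  by rewrite exprS mulrCA; apply: le_trans (xq i) _; rewrite ler_wpM2l.
by apply: cvg_geometric; rewrite ger0_norm.
Qed.

Lemma cvg0_sqrt_EFin (x : nat -> R) : x i @[i --> \oo] --> 0 ->
  (Num.sqrt (x i))%:E @[i --> \oo] --> 0%E.
Proof.
move=> x0; apply: cvg_EFin; first exact: nearW.
rewrite -[X in _ --> X](@sqrtr0 R).
by apply: continuous_cvg => //; exact: sqrt_continuous.
Qed.

End limits.

(** * Linearity and boundedness of gradient, divergence and strain *)

Section mesh_operators.
Context {R : realType} {d : nat} (Om : set 'rV[R]_d) (Th : seq 'M[R]_(d.+1, d)).
Context (mOm : measurable Om) (bOm : bounded_set Om).
Context (ThOm : forall V, V \in Th -> (simplex V)° `<=` Om).
Local Notation bm := (bounded_measurable Om).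
Implicit Types (f g : 'rV[R]_d -> R) (v w : 'rV[R]_d -> 'rV[R]_d).
Local Notation poly k f := (forall V, V \in Th -> polynomial_on k (simplex V) f).

Lemma gradient_bounded_measurable k f : poly k f ->
  forall i j, bm (fun x => gradient Th f x i j).
Proof.
move=> pf i j; under eq_fun do rewrite mxE.
exact: mesh_partial_bounded_measurable pf.
Qed.

Lemma gradientB k f g : poly k f -> poly k g ->
  gradient Th (fun x => f x - g x) = fun x => gradient Th f x - gradient Th g x.
Proof.
move=> pf pg; apply/funext => x; apply/rowP => j.
by rewrite !mxE (mesh_partialB j x pf pg).
Qed.

Lemma vgradient_bounded_measurable k v :
  (forall i, poly k (fun x => v x ord0 i)) ->
  forall i j, bm (fun x => vgradient Th v x i j).
Proof.
move=> pv i j; under eq_fun do rewrite mxE.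
exact: mesh_partial_bounded_measurable (pv i).
Qed.

Lemma vgradientB k v w x :
  (forall i, poly k (fun x => v x ord0 i)) ->
  (forall i, poly k (fun x => w x ord0 i)) ->
  vgradient Th (fun x => v x - w x) x = vgradient Th v x - vgradient Th w x.
Proof.
move=> pv pw; apply/matrixP => i j; rewrite !mxE.
rewrite -(mesh_partialB j x (pv i) (pw i)); congr mesh_partial.
by apply/funext => y; rewrite !mxE.
Qed.

Lemma divergence_bounded_measurable k v :
  (forall i, poly k (fun x => v x ord0 i)) -> bm (divergence Th v).
Proof.
by move=> pv; apply: bounded_measurable_sum => i; exact: vgradient_bounded_measurable pv _ _.
Qed.

Lemma divergenceB k v w : (forall i, poly k (fun x => v x ord0 i)) ->
  (forall i, poly k (fun x => w x ord0 i)) ->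
  divergence Th (fun x => v x - w x) = fun x => divergence Th v x - divergence Th w x.
Proof.
by move=> pv pw; apply/funext => x; rewrite /divergence (vgradientB x pv pw) raddfB.
Qed.

Lemma strain_bounded_measurable k v : (forall i, poly k (fun x => v x ord0 i)) ->
  forall i j, bm (fun x => strain Th v x i j).
Proof.
move=> pv i j; under eq_fun do rewrite /strain 2!mxE [X in _ + X]mxE.
apply: bounded_measurableZ; apply: bounded_measurableD;
  exact: vgradient_bounded_measurable pv _ _.
Qed.

Lemma strainB k v w : (forall i, poly k (fun x => v x ord0 i)) ->
  (forall i, poly k (fun x => w x ord0 i)) ->
  strain Th (fun x => v x - w x) = fun x => strain Th v x - strain Th w x.
Proof.
move=> pv pw; apply/funext => x; rewrite /strain (vgradientB x pv pw).
by rewrite raddfB -scalerBr opprD addrACA.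
Qed.

End mesh_operators.

(** * The two scalar energy estimates *)

Section energy.
Context {R : realType}.

(* Young's inequality with weight [a / c], then absorption of the half of
   [c * P] that it produces. *)
Lemma pressure_energy (a c b X P : R) : 0 < a -> 0 < c -> c * P <= a * b ->
  2 * (a / c) * b <= (a / c) ^+ 2 * X + P -> P <= (a / c) ^+ 2 * X.
Proof.
move=> a0 c0 cP young.
have : 2 * P <= 2 * (a / c) * b.
  by rewrite -mulrA ler_pM2l // -mulrAC ler_pdivlMr // mulrC.
lra.
Qed.

(** Multiplying the tested identity by [lambda] gives [2 * mu * lambda * E + X = alpha * b].
    Doubling it and applying the Young bound absorbs one of the two copies of [X]. *)
Lemma displacement_energy (mu lambda alpha b X P E : R) : 0 < lambda ->
  2 * mu * E + 1 / lambda * X = alpha / lambda * b ->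
  2 * alpha * b <= alpha ^+ 2 * P + X ->
  4 * mu * lambda * E + X <= alpha ^+ 2 * P.
Proof.
move=> l0 eq young.
have : lambda * (2 * mu * E + 1 / lambda * X) = alpha * b.
  by rewrite eq; field; rewrite gt_eqF.
have -> : lambda * (2 * mu * E + 1 / lambda * X) = 2 * (mu * lambda * E) + X.
  by field; rewrite gt_eqF.
lra.
Qed.

End energy.

(** * Error equations, contraction and convergence *)

Unset Implicit Arguments.

Theorem mainTheorem2 (R : realType) (d : nat) (d23 : d = 2%N \/ d = 3%N)
  (* domain, boundary parts, mesh *)
  (Om : set 'rV[R]_d) (domOm : polyhedral_domain Om)
  (Gd Gt Gp Gf : set 'rV[R]_d)
  (GdGt : boundary Om = Gd `|` Gt) (GpGf : boundary Om = Gp `|` Gf)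
  (mGd : surface_measurable Gd) (mGt : surface_measurable Gt)
  (mGp : surface_measurable Gp) (mGf : surface_measurable Gf)
  (Gd_gt0 : (0 < surface_measure Gd)%E) (Gp_gt0 : (0 < surface_measure Gp)%E)
  (Th : seq 'M[R]_(d.+1, d)) (meshTh : triangulation Om Th)
  (* parameters and data *)
  (mu lambda c0 alpha K dt : R)
  (mu_gt0 : 0 < mu) (lambda_gt0 : 0 < lambda) (c0_ge0 : 0 <= c0)
  (alpha_gt0 : 0 < alpha) (K_gt0 : 0 < K) (dt_gt0 : 0 < dt)
  (f h : 'rV[R]_d -> 'rV[R]_d) (Qs g2 : 'rV[R]_d -> R)
  (L2f : forall i, L2_domain Om (fun x => f x ord0 i))
  (L2h : forall i, L2_boundary Gt (fun x => h x ord0 i))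
  (L2Qs : L2_domain Om Qs) (L2g2 : L2_boundary Gf g2)
  (* coupled algorithm, time steps n-1 and n *)
  (n : nat) (n_ge1 : (1 <= n)%N)
  (u : nat -> 'rV[R]_d -> 'rV[R]_d) (xi p : nat -> 'rV[R]_d -> R)
  (prev_in : [/\ Vh Om Gd Th (u n.-1), Wh Om Th (xi n.-1) &
                 Mh Om Gp Th (p n.-1)])
  (cur_in : [/\ Vh Om Gd Th (u n), Wh Om Th (xi n) & Mh Om Gp Th (p n)])
  (coupled : forall v phi psi,
    Vh Om Gd Th v -> Wh Om Th phi -> Mh Om Gp Th psi ->
    [/\ 2 * mu * inner_mx Om (strain Th (u n)) (strain Th v)
          - inner Om (xi n) (divergence Th v)
        = inner_mx Om f v + inner_bd_mx Gt h v,
        inner Om (divergence Th (u n)) phi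
          + 1 / lambda * inner Om (xi n) phi
          - alpha / lambda * inner Om (p n) phi
        = 0 &
        (c0 + alpha ^+ 2 / lambda) * inner Om (p n) psi
          - alpha / lambda * inner Om (xi n) psi
          + K * dt * inner_mx Om (gradient Th (p n)) (gradient Th psi)
        = dt * inner Om Qs psi + dt * inner_bd Gf g2 psi
          + (c0 + alpha ^+ 2 / lambda) * inner Om (p n.-1) psi
          - alpha / lambda * inner Om (xi n.-1) psi])
  (* iterates of the decoupled algorithm in time step n *)
  (u_it : nat -> 'rV[R]_d -> 'rV[R]_d) (xi_it p_it : nat -> 'rV[R]_d -> R)
  (init : [/\ u_it 0%N = u n.-1, xi_it 0%N = xi n.-1 & p_it 0%N = p n.-1])
  (iter_in : forall i, (1 <= i)%N ->
    [/\ Vh Om Gd Th (u_it i), Wh Om Th (xi_it i) & Mh Om Gp Th (p_it i)])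
  (step1 : forall i, (1 <= i)%N -> forall psi, Mh Om Gp Th psi ->
    (c0 + alpha ^+ 2 / lambda) * inner Om (p_it i) psi
      + K * dt * inner_mx Om (gradient Th (p_it i)) (gradient Th psi)
    = (c0 + alpha ^+ 2 / lambda) * inner Om (p n.-1) psi
      + alpha / lambda * inner Om (fun x => xi_it i.-1 x - xi n.-1 x) psi
      + dt * inner Om Qs psi + dt * inner_bd Gf g2 psi)
  (step2 : forall i, (1 <= i)%N -> forall v phi,
    Vh Om Gd Th v -> Wh Om Th phi ->
    2 * mu * inner_mx Om (strain Th (u_it i)) (strain Th v)
      - inner Om (xi_it i) (divergence Th v)
    = inner_mx Om f v + inner_bd_mx Gt h v /\
    inner Om (divergence Th (u_it i)) phi + 1 / lambda * inner Om (xi_it i) phi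
    = alpha / lambda * inner Om (p_it i) phi)
  (c0_gt0 : 0 < c0) :
  [/\ L2norm Om (fun x => xi_it i x - xi n x) @[i --> \oo] --> 0%E,
      L2norm Om (fun x => p_it i x - p n x) @[i --> \oo] --> 0%E &
      L2norm_mx Om (strain Th (fun x => u_it i x - u n x)) @[i --> \oo] --> 0%E].
Proof.
move: domOm meshTh => [oOm _ _ bOm _] [_ cOm ThOm _].
have mOm : measurable Om by exact: open_measurable_row.
have finOm := bounded_lebesgue_row mOm bOm.
pose a := alpha / lambda; pose c := c0 + alpha ^+ 2 / lambda.
have a_gt0 : 0 < a by exact: divr_gt0.
have c_gt0 : 0 < c by rewrite addr_gt0// divr_gt0// exprn_gt0.
(* Membership of the iterates is assumed from index 1 on; iterate 0 is the previous time step, which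
   lies in the spaces by [prev_in]. *)
have Win i : Wh Om Th (xi_it i).
  by case: i => [|i]; [case: init => _ -> _; case: prev_in|case: (iter_in i.+1 isT)].
have Min i : Mh Om Gp Th (p_it i).
  by case: i => [|i]; [case: init => _ _ ->; case: prev_in|case: (iter_in i.+1 isT)].
have Vin i : Vh Om Gd Th (u_it i).
  by case: i => [|i]; [case: init => -> _ _; case: prev_in|case: (iter_in i.+1 isT)].
case: cur_in => Vn Wn Mn; case: prev_in => _ Wprev _.
pose exi i x := xi_it i x - xi n x.
pose ep i x := p_it i x - p n x.
pose eu i x := u_it i x - u n x.
have Wexi i : Wh Om Th (exi i) by exact: WhB.
have Mep i : Mh Om Gp Th (ep i) by exact: MhB.
have Veu i : Vh Om Gd Th (eu i) by exact: VhB.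
have bW phi : Wh Om Th phi -> bounded_measurable Om phi.
  by move=> [cphi pphi]; exact: fe_bounded_measurable cOm cphi pphi.
have bM psi : Mh Om Gp Th psi -> bounded_measurable Om psi.
  by move=> [cpsi _ ppsi]; exact: fe_bounded_measurable cOm cpsi ppsi.
have bG psi : Mh Om Gp Th psi -> forall i j,
    bounded_measurable Om (fun x => gradient Th psi x i j).
  by move=> [_ _ ppsi]; exact: gradient_bounded_measurable ppsi.
have pV v : Vh Om Gd Th v -> forall i V, V \in Th ->
    polynomial_on 2 (simplex V) (fun x => v x ord0 i).
  by move=> [_ _ pv] i V VTh; exact: pv.
have bD v : Vh Om Gd Th v -> bounded_measurable Om (divergence Th v).
  by move=> /pV; exact: divergence_bounded_measurable.
have bS v : Vh Om Gd Th v -> forall i j,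
    bounded_measurable Om (fun x => strain Th v x i j).
  by move=> /pV; exact: strain_bounded_measurable.
pose X i := inner Om (exi i) (exi i).
pose P i := inner Om (ep i) (ep i).
pose E i := inner_mx Om (strain Th (eu i)) (strain Th (eu i)).
have X_ge0 i : 0 <= X i by exact: inner_ge0.
have P_ge0 i : 0 <= P i by exact: inner_ge0.
have E_ge0 i : 0 <= E i by exact: inner_mx_ge0.
(* Both pressure equations are tested with [ep i.+1] and subtracted: data and previous-step terms
   cancel, and the gradient term left over is nonnegative. Hence [c * P i.+1] is at most [a] times
   the inner product of [exi i] and [ep i.+1]. *)
have P_le i : P i.+1 <= (a / c) ^+ 2 * X i.
  apply: (@pressure_energy _ a c (inner Om (exi i) (ep i.+1))) => //; last first.
    by apply: inner_young => //; [exact: bW|exact: bM].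
  have [_ _ cpl] := coupled _ _ _ Vn Wn (Mep i.+1).
  have := step1 i.+1 isT _ (Mep i.+1); rewrite succnK.
  rewrite innerBl //; [|exact: bW|exact: bW|exact: bM].
  have gradE : gradient Th (ep i.+1) =
      fun x => gradient Th (p_it i.+1) x - gradient Th (p n) x.
    by case: (Min i.+1) => _ _ pi; case: Mn => _ _ pn; exact: gradientB pi pn.
  have : 0 <= K * dt * inner_mx Om (gradient Th (ep i.+1)) (gradient Th (ep i.+1)).
    by rewrite mulr_ge0 ?inner_mx_ge0// mulr_ge0// ltW.
  (* Only the first argument is expanded; the second must stay the test function, so that the terms
     match those of the two equations. *)
  rewrite {1}gradE inner_mxBl //; [|exact: bG|exact: bG|exact: bG].
  have -> : P i.+1 = inner Om (p_it i.+1) (ep i.+1) - inner Om (p n) (ep i.+1).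
    by rewrite /P {1}/ep innerBl //; [exact: bM|exact: bM|exact: bM].
  have -> : inner Om (exi i) (ep i.+1) =
      inner Om (xi_it i) (ep i.+1) - inner Om (xi n) (ep i.+1).
    by rewrite /exi innerBl //; [exact: bW|exact: bW|exact: bM].
  move: cpl; rewrite -/a -/c.
  (* Once each integral is a real variable, the claim is pure arithmetic for [lra]. *)
  move: (inner Om Qs _) (inner_bd Gf g2 _) (inner Om (p n.-1) _) (inner Om (xi n.-1) _).
  move: (inner Om (p_it _) _) (inner Om (xi_it _) _) (inner Om (p n) _) (inner Om (xi n) _).
  move: (inner_mx Om (gradient Th (p_it _)) _) (inner_mx Om (gradient Th (p n)) _).
  move=> G Gn pi xii pn xin Q g pp xip cpl KG st.
  clearbody a c; lra.
have XE_le i : 4 * mu * lambda * E i.+1 + X i.+1 <= alpha ^+ 2 * P i.+1.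
  apply: (@displacement_energy _ _ _ _ (inner Om (ep i.+1) (exi i.+1))) => //; last first.
    by apply: inner_young => //; [exact: bM|exact: bW].
  have [cu cxi _] := coupled _ _ _ (Veu i.+1) (Wexi i.+1) Mn.
  have [] := step2 i.+1 isT _ _ (Veu i.+1) (Wexi i.+1).
  have strE : strain Th (eu i.+1) =
      fun x => strain Th (u_it i.+1) x - strain Th (u n) x.
    by exact: strainB (pV _ (Vin i.+1)) (pV _ Vn).
  (* The coupling term is expanded in two ways: here by splitting the divergence, as in the second
     equation, and in [divE'] by splitting [exi], as in the first. Equating the two eliminates it
     from the sum of the tested equations. *)
  have divE : inner Om (divergence Th (eu i.+1)) (exi i.+1) =
      inner Om (divergence Th (u_it i.+1)) (exi i.+1)
      - inner Om (divergence Th (u n)) (exi i.+1).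
    rewrite -innerBl //; [|exact: bD|exact: bD|exact: bW].
    by rewrite (divergenceB (pV _ (Vin i.+1)) (pV _ Vn)).
  have divE' : inner Om (divergence Th (eu i.+1)) (exi i.+1) =
      inner Om (xi_it i.+1) (divergence Th (eu i.+1))
      - inner Om (xi n) (divergence Th (eu i.+1)).
    by rewrite innerC innerBl //; [exact: bW|exact: bW|exact: bD].
  have EE : E i.+1 = inner_mx Om (strain Th (u_it i.+1)) (strain Th (eu i.+1))
      - inner_mx Om (strain Th (u n)) (strain Th (eu i.+1)).
    by rewrite /E {1}strE inner_mxBl //; [exact: bS|exact: bS|exact: bS].
  have XX : X i.+1 = inner Om (xi_it i.+1) (exi i.+1) - inner Om (xi n) (exi i.+1).
    by rewrite /X {1}/exi innerBl //; [exact: bW|exact: bW|exact: bW].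
  have PX : inner Om (ep i.+1) (exi i.+1) =
      inner Om (p_it i.+1) (exi i.+1) - inner Om (p n) (exi i.+1).
    by rewrite {1}/ep innerBl //; [exact: bM|exact: bM|exact: bW].
  rewrite EE XX PX {EE XX PX strE}; move: cu cxi divE divE' => + + ->.
  move: (inner_mx Om f _) (inner_bd_mx Gt h _).
  move: (inner_mx Om (strain Th (u_it _)) _) (inner_mx Om (strain Th (u n)) _).
  move: (inner Om (divergence Th (u_it _)) _) (inner Om (divergence Th (u n)) _).
  move: (inner Om _ (divergence Th _)) (inner Om (xi n) (divergence Th _)).
  move: (inner Om (p_it _) _) (inner Om (xi_it _) _) (inner Om (p n) _) (inner Om (xi n) _).
  by move=> *; lra.
(* Since [alpha * a] is [alpha ^+ 2 / lambda], it falls short of [c] by exactly [c0]; strictness is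
   thus [0 < c0]. *)
have rho : 0 <= (alpha * a / c) ^+ 2 < 1.
  have ac_ge0 : 0 <= alpha * a / c by rewrite ltW// divr_gt0// mulr_gt0.
  by rewrite sqr_ge0 expr_lt1 //= ltr_pdivrMr // mul1r /a /c mulrA -expr2 ltrDr.
(* Dropping the nonnegative strain term from [XE_le] and inserting [P_le] gives a contraction of
   [X]. *)
have X0 : X i @[i --> \oo] --> 0.
  apply: (contraction_cvg0 rho X_ge0) => i.
  have := XE_le i; have : 0 <= 4 * mu * lambda * E i.+1.
    by rewrite mulr_ge0// ltW// !mulr_gt0.
  have : alpha ^+ 2 * P i.+1 <= alpha ^+ 2 * ((a / c) ^+ 2 * X i).
    by rewrite ler_wpM2l ?sqr_ge0.
  have -> : alpha ^+ 2 * ((a / c) ^+ 2 * X i) = (alpha * a / c) ^+ 2 * X i by ring.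
  lra.
have cM0 (k : R) (y : nat -> R) : y i @[i --> \oo] --> 0 -> k * y i @[i --> \oo] --> 0.
  by move=> y0; rewrite -[X in _ --> X](mulr0 k); exact: cvgMr.
have P0 : P i @[i --> \oo] --> 0.
  (* The energy bounds control index [i.+1] only, so the limit is taken along the shifted
     sequence. *)
  rewrite -cvg_shiftS; apply: squeeze_cvg0 (cM0 _ _ X0) => i.
  by apply/andP; split; [exact: P_ge0|exact: P_le].
have E0 : E i @[i --> \oo] --> 0.
  rewrite -cvg_shiftS.
  have P0' : P i.+1 @[i --> \oo] --> 0 by rewrite cvg_shiftS.
  (* The constant comes from [XE_le] after discarding [X i.+1], which is nonnegative, and dividing
     by [4 * mu * lambda]. *)
  apply: squeeze_cvg0 (cM0 (alpha ^+ 2 / (4 * mu * lambda)) _ P0') => i.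
  apply/andP; split; first exact: E_ge0.
  rewrite mulrAC ler_pdivlMr ?mulr_gt0//.
  by rewrite mulrC; apply: le_trans (XE_le i); rewrite lerDl.
have int_sqr g (bg : bounded_measurable Om g) :=
  bounded_measurable_integrable mOm finOm (bounded_measurableM bg bg).
split.
- under eq_fun => i do rewrite (L2normE mOm (int_sqr _ (bW _ (Wexi i)))).
  exact: cvg0_sqrt_EFin.
- under eq_fun => i do rewrite (L2normE mOm (int_sqr _ (bM _ (Mep i)))).
  exact: cvg0_sqrt_EFin.
- under eq_fun => i do rewrite (L2norm_mxE mOm finOm (bS _ (Veu i))).
  exact: cvg0_sqrt_EFin.
Qed.
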